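(* Let $\mathcal H$ be a real Hilbert space, let $\Phi:\mathcal H\to\mathbb{R}\cup\{+\infty\}$ be a convex lower semicontinuous proper function, and let $B:\mathcal H\to\mathcal H$ be a maximal monotone operator which is $\beta$-cocoercive, $\beta>0$. Suppose that $S=\{z\in\mathcal H:\ \partial\Phi(z)+Bz\ni0\}$ is nonempty. Let $\mu>0$, and for $x_0\in\mathcal H$ let $x:[0,+\infty[\,\to\mathcal H$ be the unique classical global solution of $$\dot x(t)+x(t)-\mathrm{prox}_{\mu\Phi}\big(x(t)-\mu B(x(t))\big)=0,\qquad x(0)=x_0 .$$ 1. Suppose that $0<\mu<4\beta$. Then: i) $x(t)$ converges weakly to some $x_\infty\in S$ as $t\to+\infty$; ii) $B(x(t))$ converges strongly to $Bz$ as $t\to+\infty$, where $Bz$ is uniquely defined for $z\in S$ (i.e. it is the same vector for all $z\in S$); iii) $\lim_{t\to+\infty}\dot x(t)=0$ and $\int_0^{\infty}\|\dot x(t)\|^2\,dt<+\infty$. 2. Suppose that $B=\nabla\Psi$, where $\Psi:\mathcal H\to\mathbb{R}$ is a convex differentiable function. Then, for arbitrary $\mu>0$, the properties i), ii), iii) are satisfied.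
   Context: $\partial\Phi$ is the convex subdifferential and $\mathrm{prox}_{\mu\Phi}=(I+\mu\partial\Phi)^{-1}$ is the proximal mapping of $\mu\Phi$. $B:\mathcal H\to\mathcal H$ is $\beta$-cocoercive if $\langle Bx-By,x-y\rangle\ge\beta\|Bx-By\|^2$ for all $x,y\in\mathcal H$. The vector field governing the equation is Lipschitz continuous, so the classical ($C^1$) global solution exists and is unique for every $x_0\in\mathcal H$. *)

(* Defs.v *)
From HB Require Import structures.
From mathcomp Require Import all_boot all_order all_algebra.
From mathcomp Require Import sesquilinear.
From mathcomp Require Import all_classical all_reals all_analysis.

Set Implicit Arguments.
Unset Strict Implicit.
Unset Printing Implicit Defensive.

Import Order.TTheory GRing.Theory Num.Theory.
Import numFieldNormedType.Exports.

Local Open Scope classical_set_scope.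
Local Open Scope ring_scope.

Section Hilbert.
Context {R : realType} {H : completeNormedModType R}.

(* A real Hilbert space is a complete normed module whose norm is induced by
   a (symmetric, positive definite, bilinear) form [ip]. *)
Definition hilbert_norm (ip : {dot H for idfun}) :=
  forall u : H, `|u| ^+ 2 = ip u u.

Variable ip : {dot H for idfun}.

Definition weakly_cvg_at_pinfty (x : R -> H) (l : H) :=
  forall y : H, ip (x t) y @[t --> +oo%R] --> (ip l y : R).

(* Set-valued operators on [H] are functions [H -> set H]. *)
Definition op_le (A A' : H -> set H) := forall u, A u `<=` A' u.

Definition op_inv (A : H -> set H) : H -> set H := fun v => [set u | A u v].

Definition op_id_add (mu : R) (A : H -> set H) : H -> set H :=
  fun u => [set u + mu *: p | p in A u].

Definition monotone_op (A : H -> set H) :=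
  forall u v p q, A u p -> A v q -> 0 <= ip (p - q) (u - v).

Definition maximal_monotone_op (A : H -> set H) :=
  monotone_op A /\
  forall A' : H -> set H, monotone_op A' -> op_le A A' -> op_le A' A.

Definition cocoercive (beta : R) (B : H -> H) :=
  forall u v, beta * `|B u - B v| ^+ 2 <= ip (B u - B v) (u - v).

Definition proper_fun (Phi : H -> \bar R) :=
  (forall u, Phi u != -oo%E) /\ (exists u, Phi u != +oo%E).

(* In [\bar R] one has 0 * +oo = 0, so that the end points s = 0, 1 are
   harmless. *)
Definition econvex (Phi : H -> \bar R) :=
  forall (u v : H) (s : R), 0 <= s <= 1 ->
    (Phi (s *: u + (1 - s) *: v)%R <= s%:E * Phi u + (1 - s)%R%:E * Phi v)%E.

Definition subdiff (Phi : H -> \bar R) (u : H) : set H :=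
  [set p | forall v, (Phi u + (ip p (v - u)%R)%:E <= Phi v)%E].

(* [op_inv (op_id_add mu (subdiff Phi))] is the set-valued (I + mu dPhi)^-1.
   For [Phi] convex, lower semicontinuous and proper and [mu > 0] its values
   are singletons, and [prox mu Phi w] is the point of the singleton at [w];
   the default value [0] of [xget] is then never used. *)
Definition prox (mu : R) (Phi : H -> \bar R) (w : H) : H :=
  xget 0 (op_inv (op_id_add mu (subdiff Phi)) w).

Definition solution_set (Phi : H -> \bar R) (B : H -> H) : set H :=
  [set z | [set p + B z | p in subdiff Phi z] 0].

(* [v] is the derivative at [t] of the restriction of [x] to [0, +oo[, hence
   the right derivative at [t = 0] and the usual derivative for [t > 0]. *)
Definition is_derive_ray (x : R -> H) (t : R) (v : H) :=
  (s - t)^-1 *: (x s - x t) @[s --> within (`[0, +oo[%classic : set R) t^'] --> v.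

(* [x] is a C^1 solution on [0, +oo[, with derivative [dx]; the values of
   [x] and [dx] on the negative reals are irrelevant. *)
Definition classical_solution (mu : R) (Phi : H -> \bar R) (B : H -> H)
    (x0 : H) (x dx : R -> H) :=
  [/\ forall t : R, 0 <= t -> is_derive_ray x t (dx t),
      {within `[0, +oo[%classic, continuous dx},
      forall t : R, 0 <= t ->
        dx t + x t - prox mu Phi (x t - mu *: B (x t)) = 0
    & x 0 = x0].

Definition is_gradient (Psi : H -> R) (B : H -> H) :=
  forall u, differentiable (Psi : H -> R^o) u /\
    forall h, 'd (Psi : H -> R^o) u h = ip (B u) h.

Definition asymptotic_properties (Phi : H -> \bar R) (B : H -> H)
    (x dx : R -> H) :=
  [/\ exists2 xoo, solution_set Phi B xoo & weakly_cvg_at_pinfty x xoo,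
      (forall z z', solution_set Phi B z -> solution_set Phi B z' ->
         B z = B z') /\
      (forall z, solution_set Phi B z -> B (x t) @[t --> +oo%R] --> B z)
    & dx t @[t --> +oo%R] --> (0 : H) /\
      (\int[lebesgue_measure]_(t in `[0%R, +oo[) (`|dx t| ^+ 2)%:E < +oo)%E].

End Hilbert.

(* Main.v *)
(* Write [S] for the solution set and [h z t = |x t - z|^2 / 2]. The equation
   says that [- dx / mu - B x] is a subgradient of [Phi] at [x + dx]; comparing
   with the subgradient [- B z] at [z] in [S] and using cocoercivity gives
     (h z)' / mu + |dx|^2 / mu + beta |B x - B z|^2 + <B x - B z, dx> <= 0.
   If [mu < 4 beta], the cross term is absorbed by the two squares, so that
   [h z] is a strict Lyapunov function. If [B] is the gradient of [Psi], the
   cross term is the time derivative of the Bregman distance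
   [Psi x - Psi z - <B z, x - z> >= 0], which is added to [h z / mu] instead.
   In both cases the dissipation controls [|dx|^2 + |B x - B z|^2], hence
   square integrability and, the trajectory being Lipschitz, convergence of
   both terms to 0. Weak cluster points (limits along ultrafilters finer than
   the one of [+oo]) lie in [S] by maximality of the two monotone operators.
   They are unique by Opial's argument, since the difference of the Lyapunov
   functions attached to two points of [S] is affine in [x]. *)
Require Import Defs.
From HB Require Import structures.
From mathcomp Require Import all_boot all_order all_algebra.
From mathcomp Require Import sesquilinear.
From mathcomp Require Import all_classical all_reals all_analysis.
From mathcomp Require Import measurable_realfun ring lra.

Set Implicit Arguments.
Unset Strict Implicit.
Unset Printing Implicit Defensive.

Import Order.TTheory GRing.Theory Num.Theory.
Import numFieldNormedType.Exports.

Local Open Scope classical_set_scope.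
Local Open Scope ring_scope.

(** * Inner product calculus and gradients *)

Section InnerProduct.
Context {R : realType} {H : completeNormedModType R} (ip : {dot H for idfun}).

Lemma ipC u v : ip u v = ip v u.
Proof. by rewrite (hermC ip) expr0 mul1r. Qed.

Lemma ipDl u v w : ip (u + v) w = ip u w + ip v w.
Proof. by rewrite linearDl. Qed.

Lemma ipDr u v w : ip w (u + v) = ip w u + ip w v.
Proof. by rewrite linearDr. Qed.

Lemma ipNl u w : ip (- u) w = - ip u w.
Proof. by rewrite linearNl. Qed.

Lemma ipNr u w : ip w (- u) = - ip w u.
Proof. by rewrite linearNr. Qed.

Lemma ipZl (a : R) u w : ip (a *: u) w = a * ip u w.
Proof. by rewrite linearZl_LR. Qed.

Lemma ipZr (a : R) u w : ip w (a *: u) = a * ip w u.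
Proof. by rewrite linearZr_LR. Qed.

Definition ipE := (ipDl, ipDr, ipNl, ipNr, ipZl, ipZr).

Context (ip_norm : hilbert_norm ip).

Lemma sqr_normD u v : `|u + v| ^+ 2 = `|u| ^+ 2 + 2 * ip u v + `|v| ^+ 2.
Proof. by rewrite !ip_norm !ipE (ipC v u); ring. Qed.

Lemma sqr_normB u v : `|u - v| ^+ 2 = `|u| ^+ 2 - 2 * ip u v + `|v| ^+ 2.
Proof. by rewrite !ip_norm !ipE (ipC v u); ring. Qed.

Lemma cauchy_schwarz u v : `|ip u v| <= `|u| * `|v|.
Proof.
have [->|v0] := eqVneq v 0.
  by rewrite -(scale0r (0 : H)) ipZr mul0r normr0 mulr_ge0.
have v2 : 0 < `|v| ^+ 2 by rewrite exprn_gt0 ?normr_gt0.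
rewrite -ler_sqr ?nnegrE ?mulr_ge0// exprMn real_normK ?num_real//.
(* Up to the factor [|v|], this vector is the component of [u] orthogonal to [v]; its squared norm
   is [|v| ^+ 2] times the Gram determinant of [u] and [v]. *)
have := sqr_ge0 `| `|v| ^+ 2 *: u - ip u v *: v|.
rewrite ip_norm !ipE -!ip_norm (ipC v u) => h.
have : 0 <= `|v| ^+ 2 * (`|u| ^+ 2 * `|v| ^+ 2 - ip u v ^+ 2).
  by move: h; lra.
by rewrite pmulr_rge0// subr_ge0.
Qed.

Lemma ip_le u v : ip u v <= `|u| * `|v|.
Proof. exact: le_trans (ler_norm _) (cauchy_schwarz _ _). Qed.

Lemma ip_continuousr g : continuous (ip g : H -> R).
Proof.
move=> u; apply/cvgrPdist_le => e e0.
have g1 : 0 < `|g| + 1 by rewrite ltr_wpDl.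
near=> v.
rewrite -ipNr -ipDr (le_trans (cauchy_schwarz _ _))//.
rewrite (@le_trans _ _ ((`|g| + 1) * `|u - v|))//.
  by rewrite ler_wpM2r// lerDl.
rewrite -ler_pdivlMl// mulrC; near: v.
by apply: cvgr_dist_le => //; rewrite divr_gt0.
Unshelve. all: by end_near. Qed.

(** Once [ip (G u)] is packed as a continuous linear map, uniqueness of the differential identifies
    it with ['d F u]. *)
Lemma is_gradient_littleo (F : H -> R) (G : H -> H) :
  (forall u e, 0 < e -> \forall h \near (0 : H),
     `|F (h + u) - F u - ip (G u) h| <= e * `|h|) ->
  is_gradient ip F G.
Proof.
move=> FG u.
pose dF : {linear H -> R^o} := HB.pack (ip (G u) : H -> R^o)
  (GRing.isLinear.Build _ _ _ _ _ (fun a x y =>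
     etrans (ipDr (a *: x) y (G u)) (congr1 (+%R^~ _) (ipZr a x (G u))))).
have dFo : (F : H -> R^o) \o shift u = cst (F u : R^o) + dF +o_ (0:H) id.
  apply/eqaddoP => e e0; near=> h.
  rewrite /= opprD addrA.
  by near: h; exact: FG.
have E := diff_unique (ip_continuousr (g := G u) : continuous dF) dFo.
split; last by move=> h; rewrite E.
apply/diff_locallyP; rewrite E; split => //; exact: ip_continuousr.
Unshelve. all: by end_near. Qed.

Lemma is_gradientD F F' G G' : is_gradient ip F G -> is_gradient ip F' G' ->
  is_gradient ip (F \+ F') (G \+ G').
Proof.
move=> FG FG' u; have [dF EF] := FG u; have [dF' EF'] := FG' u; split.
  exact: differentiableD.
by move=> h; rewrite diffD//= [LHS]/= ipDl -EF -EF'.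
Qed.

Lemma is_gradient_affine (g : H) (k : R) :
  is_gradient ip (fun u => ip g u + k) (fun=> g).
Proof.
apply: is_gradient_littleo => u e e0; near=> h.
rewrite /= ipDr [X in `|X|](_ : _ = 0); last ring.
by rewrite normr0 mulr_ge0// ltW.
Unshelve. all: by end_near. Qed.

Lemma is_gradient_sqr_norm (k : R) (z : H) :
  is_gradient ip (fun u => k * `|u - z| ^+ 2) (fun u => (2 * k) *: (u - z)).
Proof.
apply: is_gradient_littleo => u e e0; near=> h.
rewrite /= -(addrA h) sqr_normD ipZl (ipC h).
rewrite [X in `|X|](_ : _ = k * `|h| ^+ 2); last ring.
rewrite normrM normrX normr_id expr2 mulrA ler_wpM2r//.
have k1 : 0 < `|k| + 1 by rewrite ltr_wpDl.
rewrite (@le_trans _ _ ((`|k| + 1) * `|h|)) ?ler_wpM2r ?lerDl//.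
rewrite -ler_pdivlMl// mulrC -[h]opprK normrN -[- h]add0r.
by near: h; apply: cvgr_dist_le => //; rewrite divr_gt0.
Unshelve. all: by end_near. Qed.

End InnerProduct.

(** * Existence of resolvents of the subdifferential *)

Section Resolvent.
Context {R : realType} {H : completeNormedModType R} (ip : {dot H for idfun}).
Context (ip_norm : hilbert_norm ip).
Implicit Types (Phi : H -> \bar R) (u v w p : H).

Lemma ge0_of_le_small (X Y : R) : 0 <= Y ->
  (forall s, 0 < s <= 1 -> 0 <= X + s * Y) -> 0 <= X.
Proof.
move=> Y0 h; rewrite leNgt; apply/negP => X0.
have d0 : 0 < Y + 1 - X by lra.
(* If [X < 0], this [s] lies in []0, 1]], and [X + s * Y] has the sign of [X * (1 - X) < 0]. *)
have := h (- X / (Y + 1 - X)).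
rewrite divr_gt0 ?oppr_gt0//= ler_pdivrMr// mul1r => /(_ ltac:(lra)).
rewrite -(pmulr_rge0 _ d0) mulrDr [X in _ + X](_ : _ = - X * Y); first nra.
by field; lra.
Qed.

Lemma econvex_fin Phi u v (s a b : R) : econvex Phi -> proper_fun Phi ->
  0 <= s <= 1 -> Phi u = a%:E -> Phi v = b%:E ->
  exists2 c, Phi (s *: u + (1 - s) *: v) = c%:E & c <= s * a + (1 - s) * b.
Proof.
move=> cvx [Phi_ninfty _] s01 ua vb; have := cvx u v s s01.
rewrite ua vb -!EFinM -EFinD.
case: (Phi _) (Phi_ninfty (s *: u + (1 - s) *: v)) => // c _.
by rewrite lee_fin; exists c.
Qed.

Lemma sqr_norm_convex_comb u v w (s : R) :
  `|s *: u + (1 - s) *: v - w| ^+ 2 =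
  s * `|u - w| ^+ 2 + (1 - s) * `|v - w| ^+ 2 - s * (1 - s) * `|u - v| ^+ 2.
Proof.
rewrite !ip_norm !ipE (ipC ip v u) (ipC ip w u) (ipC ip w v); ring.
Qed.

(** Direct method without weak topology: the quadratic term makes minimizing sequences Cauchy, and
    lower semicontinuity handles their strong limit. *)
Lemma tikhonov_minimizer Phi (k m : R) w :
  econvex Phi -> lower_semicontinuous Phi -> proper_fun Phi -> 0 < k ->
  (forall u, (m%:E <= Phi u + (k * `|u - w| ^+ 2)%:E)%E) ->
  exists v, exists2 a, Phi v = a%:E &
    forall u b, Phi u = b%:E -> a + k * `|v - w| ^+ 2 <= b + k * `|u - w| ^+ 2.
Proof.
move=> cvx lsc prop k0 lb; have [Phi_ninfty [u0 Phi_u0]] := prop.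
pose q u := k * `|u - w| ^+ 2.
(* The finite values of [Phi + q], written so that the infimum is taken in [R]. *)
pose E := [set r : R | exists u, Phi u = (r - q u)%:E].
have infE : has_inf E.
  split.
    move: Phi_u0 (Phi_ninfty u0); case Eu0 : (Phi u0) => [a| |]// _ _.
    by exists (a + q u0), u0; rewrite Eu0 addrK.
  exists m => r [u Er]; have := lb u.
  by rewrite Er -EFinD lee_fin -/(q u) subrK.
pose i := inf E.
have i_le u b : Phi u = b%:E -> i <= b + q u.
  by move=> ub; apply: ge_inf; [exact: infE.2 | exists u; rewrite addrK].
have /choice[u_ u_P] : forall n, exists u,
    exists2 a, Phi u = a%:E & a + q u < i + n.+1%:R^-1.
  move=> n.
  have n0 : 0 < n.+1%:R^-1 :> R by rewrite invr_gt0.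
  have [r [u Eu] ri] := inf_adherent n0 infE.
  by exists u, (r - q u) => //; rewrite subrK.
(* Strong convexity: two almost minimizers are close, since their midpoint
   cannot go below the infimum. *)
have close n l : k * `|u_ n - u_ l| ^+ 2 <= 2 * (n.+1%:R^-1 + l.+1%:R^-1).
  have [a ua alt] := u_P n; have [b ub blt] := u_P l.
  have s01 : (0 <= (2^-1 : R)) && ((2^-1 : R) <= 1).
    by rewrite invr_ge0 ler0n invf_le1 ?ler1n.
  have [c Ec cle] := econvex_fin cvx prop s01 ua ub.
  have := i_le _ _ Ec; rewrite /q sqr_norm_convex_comb.
  move: alt blt cle; rewrite /q; move: (n.+1%:R^-1) (l.+1%:R^-1) => n' l'.
  by lra.
have [v u_v] : exists v, u_ n @[n --> \oo] --> v.
  apply/cvg_ex; apply/cauchy_cvgP/cauchy_exP => e e0.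
  have ke0 : 0 < k * e ^+ 2 / 4 by rewrite divr_gt0// mulr_gt0// exprn_gt0.
  have [N _ NP] := near_infty_natSinv_lt (PosNum ke0).
  exists (u_ N); exists N => // n /= Nn; rewrite -ball_normE /=.
  rewrite -ltr_sqr ?nnegrE ?(ltW e0)// -(ltr_pM2l k0).
  apply: le_lt_trans (close _ _) _.
  have /= := NP N (leqnn _); have /= := NP n Nn.
  by move: (n.+1%:R^-1) (N.+1%:R^-1) => n' N'; lra.
have q_cont : continuous q.
  by move=> u; apply: differentiable_continuous;
    have [] := is_gradient_sqr_norm ip_norm k w u.
(* Otherwise [Phi] exceeds [i - q v + d] near [v], whereas [Phi (u_ n)] is below [i - q (u_ n)] plus
   a vanishing error and [q] is continuous. *)
have Phi_v : (Phi v <= (i - q v)%:E)%E.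
  rewrite leNgt; apply/negP => lt_Phi_v.
  have [d d0 d_Phi] : exists2 d, 0 < d & ((i - q v + d)%:E < Phi v)%E.
    move: lt_Phi_v; case: (Phi v) => [a|_|]//; last by exists 1; rewrite ?ltry.
    rewrite lte_fin => lta; exists ((a - (i - q v)) / 2); first lra.
    by rewrite lte_fin; lra.
  have [V Vv VP] := lsc _ _ d_Phi.
  have d2 : 0 < d / 2 by lra.
  have : \forall n \near \oo, False.
    near=> n.
    have /VP : V (u_ n) by near: n; exact: u_v.
    have [a -> alt] := u_P n; rewrite lte_fin.
    have : `|q v - q (u_ n)| < d / 2.
      near: n; move: d2; apply: cvgr_dist_lt.
      exact: (continuous_cvg _ (q_cont v) u_v).
    rewrite ltr_norml => /andP[q1 q2].
    have : n.+1%:R^-1 < d / 2.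
      by near: n; exact: (near_infty_natSinv_lt (PosNum d2)).
    by move: alt; move: (n.+1%:R^-1) => n'; lra.
  by move=> /filter_ex [].
move: Phi_v (Phi_ninfty v); case Ev : (Phi v) => [a| |]// + _.
rewrite lee_fin => a_le; exists v, a => // u b /i_le; rewrite -/(q v) -/(q u).
lra.
Unshelve. all: by end_near. Qed.

Lemma resolvent_exists Phi (mu m : R) w :
  econvex Phi -> lower_semicontinuous Phi -> proper_fun Phi -> 0 < mu ->
  (forall u, (m%:E <= Phi u + ((2 * mu)^-1 * `|u - w| ^+ 2)%:E)%E) ->
  exists v, subdiff ip Phi v (mu^-1 *: (w - v)).
Proof.
move=> cvx lsc prop mu0 lb.
have k0 : 0 < (2 * mu)^-1 by rewrite invr_gt0 mulr_gt0.
have [v [a Ev vmin]] := tikhonov_minimizer cvx lsc prop k0 lb.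
exists v => y; rewrite Ev.
case Ey : (Phi y) (prop.1 y) => [b| |]// _; last by rewrite leey.
rewrite -EFinD lee_fin -subr_ge0.
(* Fermat's rule: compare the minimizer [v] with [s *: y + (1 - s) *: v], divide by [s], and let [s]
   tend to 0. *)
apply: (@ge0_of_le_small _ ((2 * mu)^-1 * `|y - v| ^+ 2)).
  exact: mulr_ge0 (ltW k0) (sqr_ge0 _).
move=> s /andP[s0 s1]; have s01 : 0 <= s <= 1 by rewrite (ltW s0).
have [c Ec cle] := econvex_fin cvx prop s01 Ey Ev.
have := vmin _ _ Ec; rewrite sqr_norm_convex_comb.
have -> : `|y - w| ^+ 2 = `|y - v| ^+ 2 - 2 * ip (w - v) (y - v) + `|v - w| ^+ 2.
  rewrite !ip_norm !ipE (ipC ip v y) (ipC ip w y) (ipC ip v w); ring.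
rewrite -(pmulr_rge0 _ s0) ipZl => h.
set n2 := `|y - v| ^+ 2 in h *; set g := ip _ _ in h *.
have -> : s * (b - (a + mu^-1 * g) + s * ((2 * mu)^-1 * n2)) =
  s * b + (1 - s) * a - a + (2 * mu)^-1 * (s * (n2 - 2 * g) - s * (1 - s) * n2).
  by field; rewrite gt_eqF.
set k := (2 * mu)^-1 in h *.
by move: h; lra.
Qed.

End Resolvent.

(** * The proximal mapping and maximality of the subdifferential *)

Section ProximalMapping.
Context {R : realType} {H : completeNormedModType R} (ip : {dot H for idfun}).
Context (ip_norm : hilbert_norm ip).
Implicit Types (u v w p g z : H) (mu : R).

(** Monotonicity yields firm nonexpansiveness, [|v - v'| ^+ 2 <= ip (w - w') (v - v')];
    Cauchy-Schwarz finishes. *)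
Lemma resolvent_nonexpansive (A : H -> set H) mu v v' w w' :
  monotone_op ip A -> 0 < mu ->
  A v (mu^-1 *: (w - v)) -> A v' (mu^-1 *: (w' - v')) ->
  `|v - v'| <= `|w - w'|.
Proof.
move=> monoA mu0 Av Av'; have := monoA _ _ _ _ Av Av'.
rewrite -scalerBr ipZl pmulr_rge0 ?invr_gt0// => h.
have {}h : `|v - v'| ^+ 2 <= ip (w - w') (v - v').
  move: h; rewrite [w - v - _](_ : _ = (w - w') - (v - v')).
    by rewrite ipDl ipNl -ip_norm subr_ge0.
  by rewrite !opprB addrACA [RHS]addrACA (addrC (- v)).
have [->|vv'] := eqVneq (v - v') 0; first by rewrite normr0.
rewrite -(ler_pM2r (_ : 0 < `|v - v'|)) ?normr_gt0// -expr2.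
exact: le_trans h (ip_le ip_norm _ _).
Qed.

Context (Phi : H -> \bar R) (Phi_convex : econvex Phi).
Context (Phi_lsc : lower_semicontinuous Phi) (Phi_proper : proper_fun Phi).

Lemma subdiff_fin u p : subdiff ip Phi u p -> exists a, Phi u = a%:E.
Proof.
move=> up; case Eu : (Phi u) (Phi_proper.1 u) => [a| |]// _; first by exists a.
by have [v] := Phi_proper.2; have := up v; rewrite Eu addye// leye_eq => ->.
Qed.

Lemma subdiff_monotone : monotone_op ip (subdiff ip Phi).
Proof.
move=> u v p q up vq.
have [a Eu] := subdiff_fin up; have [b Ev] := subdiff_fin vq.
have := up v; have := vq u; rewrite Eu Ev -!EFinD !lee_fin !ipE.
by lra.
Qed.

Context (z g : H) (zg : subdiff ip Phi z g).

(* The subgradient [g] provides the affine minorant that makes the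
   regularized problem bounded below. *)
Lemma prox_subdiff mu w : 0 < mu ->
  subdiff ip Phi (prox ip mu Phi w) (mu^-1 *: (w - prox ip mu Phi w)).
Proof.
move=> mu0.
have [a Ez] := subdiff_fin zg.
have [v Ev] : exists v, subdiff ip Phi v (mu^-1 *: (w - v)).
  apply: (resolvent_exists ip_norm (m := a + ip g (w - z) - mu / 2 * `|g| ^+ 2)) => //.
  move=> u; have := zg u; rewrite Ez.
  case: (Phi u) (Phi_proper.1 u) => [b| |]// _; last by rewrite addye// !leey.
  rewrite -!EFinD !lee_fin => h.
  (* Completing the square: [m] is the minimum of the affine minorant plus the quadratic term. *)
  have : 0 <= (2 * mu)^-1 * `|u - w + mu *: g| ^+ 2.
    by rewrite mulr_ge0 ?sqr_ge0// invr_ge0 mulr_ge0// ltW.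
  rewrite (sqr_normD ip_norm) ipZr normrZ exprMn (gtr0_norm mu0) => h2.
  have : (2 * mu)^-1 * (`|u - w| ^+ 2 + 2 * (mu * ip (u - w) g)
      + mu ^+ 2 * `|g| ^+ 2) = (2 * mu)^-1 * `|u - w| ^+ 2 + ip (u - w) g
      + mu / 2 * `|g| ^+ 2 by field; rewrite gt_eqF.
  move: h2 => /[swap] -> h2.
  by move: h h2; rewrite (ipC ip (u - w)) !ipE; lra.
have wv : op_inv (op_id_add mu (subdiff ip Phi)) w v.
  exists (mu^-1 *: (w - v)) => //.
  by rewrite scalerA divff ?gt_eqF// scale1r addrC subrK.
(* The set is inhabited by [v], so [xget] returns one of its elements and not the default 0. *)
have := xgetPex 0 (ex_intro _ v wv); rewrite -/(prox ip mu Phi w).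
move: (prox _ _ _ _) => u [p up <-].
by rewrite addrAC subrr add0r scalerA mulVf ?gt_eqF// scale1r.
Qed.

Lemma prox_nonexpansive mu w w' : 0 < mu ->
  `|prox ip mu Phi w - prox ip mu Phi w'| <= `|w - w'|.
Proof.
move=> mu0; exact: resolvent_nonexpansive subdiff_monotone mu0
  (prox_subdiff _ mu0) (prox_subdiff _ mu0).
Qed.

(** Both sides are resolvents of the same argument, so nonexpansiveness puts them at distance 0. *)
Lemma prox_fixpoint mu v p : 0 < mu -> subdiff ip Phi v p ->
  prox ip mu Phi (v + mu *: p) = v.
Proof.
move=> mu0 vp; apply/eqP; rewrite -subr_eq0 -normr_le0.
rewrite -[leRHS](normr0 H) -(subrr (v + mu *: p)).
apply: (resolvent_nonexpansive subdiff_monotone mu0 (prox_subdiff _ mu0)).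
by rewrite (addrC v) addrK scalerA mulVf ?gt_eqF// scale1r.
Qed.

(* Minty: a point monotonically related to the graph of the subdifferential
   belongs to it, as one sees by testing with the resolvent at [v + p]. *)
Lemma subdiff_maximal v p :
  (forall u q, subdiff ip Phi u q -> 0 <= ip (p - q) (v - u)) ->
  subdiff ip Phi v p.
Proof.
move=> h; have := prox_subdiff (v + p) ltr01.
set u := prox _ _ _ _; rewrite invr1 scale1r => uq.
have := h _ _ uq; have -> : p - (v + p - u) = - (v - u).
  by rewrite !opprB opprD addrCA (addrC p) subrK.
rewrite ipNl -ip_norm oppr_ge0 => le0.
have /eqP : `|v - u| ^+ 2 == 0 by rewrite eq_le le0 sqr_ge0.
move/eqP; rewrite sqrf_eq0 normr_eq0 subr_eq0 => /eqP vu.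
by move: uq; rewrite -vu addrAC subrr add0r.
Qed.

End ProximalMapping.

(** * Riesz representation and weak compactness along ultrafilters *)

Section WeakCompactness.
Context {R : realType} {H : completeNormedModType R} (ip : {dot H for idfun}).
Context (ip_norm : hilbert_norm ip).

(* The representing vector is the minimizer of [|u|^2 / 2 - l u]. *)
Lemma riesz_representation (l : H -> R) (M : R) :
  (forall a u v, l (a *: u + v) = a * l u + l v) ->
  (forall u, `|l u| <= M * `|u|) ->
  exists v, forall u, l u = ip v u.
Proof.
move=> lin bnd.
have lD u v : l (u + v) = l u + l v by rewrite -[u]scale1r lin scale1r mul1r.
have l0 : l 0 = 0 by have := lD 0 0; rewrite addr0; lra.
have lN u : l (- u) = - l u by have := lD u (- u); rewrite subrr l0; lra.
have lZ a u : l (a *: u) = a * l u by rewrite -[a *: u]addr0 lin l0 addr0.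
have lc : continuous l.
  move=> u; apply/cvgrPdist_le => e e0.
  have M1 : 0 < `|M| + 1 by rewrite ltr_wpDl.
  near=> v; rewrite -lN -lD (le_trans (bnd _))//.
  rewrite (@le_trans _ _ ((`|M| + 1) * `|u - v|))//.
    by rewrite ler_wpM2r// (le_trans (ler_norm _))// lerDl.
  rewrite -ler_pdivlMl// mulrC; near: v.
  by apply: cvgr_dist_le => //; rewrite divr_gt0.
pose Phi u := (- l u)%:E.
have cvx : econvex Phi.
  by move=> u v s s01; rewrite /Phi -!EFinM -EFinD lee_fin lin lZ; lra.
have lsc : lower_semicontinuous Phi.
  move=> u a; rewrite lte_fin => au.
  exists [set v | a < - l v]; last by move=> v; rewrite lte_fin.
  have lNu : - l v @[v --> u] --> - l u by apply: cvgN; exact: lc.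
  exact: (cvgr_gt _ lNu _ au).
have prop : proper_fun Phi by split=> //; exists 0.
(* The lower bound is Young's inequality [M * |u| <= M ^+ 2 / 2 + |u| ^+ 2 / 2]. *)
have [|v vl] := resolvent_exists ip_norm (m := - (M ^+ 2 / 2)) (w := 0)
    cvx lsc prop ltr01.
  move=> u; rewrite -EFinD lee_fin subr0 mulr1.
  have := ler_norm (l u); have := bnd u; have := sqr_ge0 (`|u| - M).
  by rewrite sqrrB; lra.
have le u : l u <= ip v u.
  have := vl (u + v); rewrite /Phi -EFinD lee_fin lD addrK sub0r.
  by rewrite invr1 scale1r ipNl; lra.
exists v => u; apply/eqP; rewrite eq_le le/=.
by have := le (- u); rewrite lN ipNr lerN2.
Unshelve. all: by end_near. Qed.

(** Compactness of [[- M, M]] gives a cluster point, and a cluster point of an ultrafilter is its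
    limit. *)
Lemma ultra_bounded_cvg (T : Type) (U : set_system T) (f : T -> R) (M : R) :
  UltraFilter U -> (\forall t \near U, `|f t| <= M) ->
  exists2 p : R, `|p| <= M & f t @[t --> U] --> p.
Proof.
move=> UU fM; have UP := @ultra_proper _ _ UU.
have FA : (f t @[t --> U]) `[- M, M]%classic.
  by apply: filterS fM => t; rewrite /= in_itv/= -ler_norml.
have [p [/= pM pcl]] := @segment_compact R _ _ _ _ FA.
exists p; first by move: pM; rewrite in_itv/= -ler_norml.
move=> V Vp; have [//|UnV] := in_ultra_setVsetC (f @^-1` V) UU.
by have [q []] := pcl (~` V) V UnV Vp.
Qed.

(** The limits of [ip (x t) y] along [U] form a bounded linear functional of [y], which Riesz
    represents by the weak limit. *)
Lemma ultra_bounded_weakly_cvg (T : Type) (U : set_system T) (x : T -> H)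
    (M : R) :
  UltraFilter U -> (\forall t \near U, `|x t| <= M) ->
  exists v, forall y, ip (x t) y @[t --> U] --> (ip v y : R).
Proof.
move=> UU xM; have UP := @ultra_proper _ _ UU.
have /choice[l lP] y : exists p : R,
    `|p| <= M * `|y| /\ ip (x t) y @[t --> U] --> p.
  have [|p pM px] :=
      ultra_bounded_cvg (f := fun t => ip (x t) y) (M := M * `|y|) UU.
    apply: filterS xM => t xtM.
    by rewrite (le_trans (cauchy_schwarz ip_norm _ _))// ler_wpM2r.
  by exists p.
have [| |v lv] := @riesz_representation l M.
- move=> a u v; apply/esym.
  have h : ip (x t) (a *: u + v) @[t --> U] --> a * l u + l v.
    under eq_fun do rewrite ipDr ipZr.
    by apply: cvgD; [apply: cvgM; [exact: cvg_cst|exact: (lP u).2]|exact: (lP v).2].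
  exact: (cvg_unique _ h (lP _).2).
- by move=> u; exact: (lP u).1.
by exists v => y; rewrite -lv; exact: (lP y).2.
Qed.

(** If convergence fails for some neighbourhood [V], the times at which [V] is missed support an
    ultrafilter finer than [+oo], which contradicts the hypothesis. *)
Lemma weakly_cvg_of_ultra (x : R -> H) (l : H) :
  (forall U : set_system R, UltraFilter U -> +oo%R `<=` U ->
    forall y, ip (x t) y @[t --> U] --> (ip l y : R)) ->
  weakly_cvg_at_pinfty ip x l.
Proof.
move=> xl y V Vl; apply: contrapT => nV.
pose D := ~` ((fun t => ip (x t) y) @^-1` V).
have GP : ProperFilter (within D +oo%R).
  apply: Build_ProperFilter => D0; apply: nV.
  change (\forall t \near +oo%R, V (ip (x t) y)).
  by move: D0; rewrite /within/=; apply: filterS => t h; apply: contrapT => /h.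
have [U [UU GU]] := ultraFilterLemma GP; have UP := @ultra_proper _ _ UU.
have UD : U D by apply: GU; exact: nearW.
have UV : U ((fun t => ip (x t) y) @^-1` V).
  apply: (xl U UU _ y V Vl) => A Ay; apply: GU.
  by rewrite /within/=; apply: filterS Ay => t At _.
by have [t []] := filter_ex (filterI UD UV).
Qed.

End WeakCompactness.

(** * Scalar Lyapunov functions on the half-line *)

Section RealFunctionsOnRay.
Context {R : realType}.
Implicit Types (f df g q : R -> R).

Definition derivable_on_ray f df :=
  {within `[0, +oo[%classic, continuous f} /\
  forall t : R, 0 < t -> is_derive t (1 : R) f (df t).

Lemma ray_mean_value f df (s t : R) : derivable_on_ray f df ->
  0 <= s -> s < t -> exists2 c, s < c < t & f t - f s = df c * (t - s).
Proof.
move=> [fc fd] s0 st.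
have [c|  |c] := @MVT R f df s t st.
- by rewrite in_itv/= => /andP[sc _]; apply: fd; exact: le_lt_trans sc.
- apply: continuous_subspaceW fc => r /=.
  by rewrite !in_itv/= andbT => /andP[sr _]; exact: le_trans sr.
- by rewrite in_itv/= => sct E; exists c.
Qed.

Lemma ray_nonincreasing f df : derivable_on_ray f df ->
  (forall t, 0 < t -> df t <= 0) ->
  forall s t, 0 <= s -> s <= t -> f t <= f s.
Proof.
move=> fd df0 s t s0; rewrite le_eqVlt => /predU1P[->//|st].
have [c /andP[sc _] E] := ray_mean_value fd s0 st.
rewrite -subr_le0 E mulr_le0_ge0 ?subr_ge0 ?(ltW st)// df0//.
exact: le_lt_trans sc.
Qed.

Lemma nonincreasing_ray_cvg f (m : R) :
  (forall s t, 0 <= s -> s <= t -> f t <= f s) ->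
  (forall t, 0 <= t -> m <= f t) ->
  exists2 l, f t @[t --> +oo] --> l & forall t, 0 <= t -> l <= f t.
Proof.
move=> fdecr fm; pose E := [set f t | t in [set t | 0 <= t]].
have infE : has_inf E.
  by split; [exists (f 0), 0 => /= | exists m => _ [t t0 <-]; exact: fm].
have le_inf t : 0 <= t -> inf E <= f t.
  by move=> t0; apply: ge_inf; [exact: infE.2 | exists t].
exists (inf E) => //; apply/cvgrPdist_le => e e0.
have [_ [T /= T0 <-] fT] := inf_adherent e0 infE.
near=> t.
have Tt : T <= t by near: t; apply: nbhs_pinfty_ge; exact: num_real.
have t0 : 0 <= t := le_trans T0 Tt.
rewrite distrC ger0_norm ?subr_ge0 ?le_inf//.
by have := fdecr _ _ T0 Tt; lra.
Unshelve. all: by end_near. Qed.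

(** Barbalat's argument: a late value [g t >= e] stays above [e / 2] for a time [d] by the Lipschitz
    bound, so [f] drops by a fixed [eta], although it is already within [eta] of its limit. *)
Lemma lyapunov_decay_cvg0 f df g (c L m : R) :
  derivable_on_ray f df -> 0 < c -> 0 <= L ->
  (forall t, 0 <= t -> m <= f t) ->
  (forall t, 0 <= t -> df t <= - (c * g t ^+ 2)) ->
  (forall t, 0 <= g t) ->
  (forall s t, 0 <= s -> s <= t -> `|g s - g t| <= L * (t - s)) ->
  g t @[t --> +oo] --> (0 : R).
Proof.
move=> fd c0 L0 fm dfg g0 gL.
have df0 t : 0 < t -> df t <= 0.
  move=> t0; apply: le_trans (dfg _ (ltW t0)) _.
  by rewrite oppr_le0 mulr_ge0 ?sqr_ge0// ltW.
have [l fl lf] := nonincreasing_ray_cvg (ray_nonincreasing fd df0) fm.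
apply/cvgrPdist_lt => e e0.
(* Here [(L + 1) * d = e / 2]; using [L + 1] also covers [L = 0]. *)
pose d := e / (2 * (L + 1)); pose eta := c * (e / 2) ^+ 2 * d.
have L1 : 0 < 2 * (L + 1) by lra.
have d0 : 0 < d by rewrite divr_gt0.
have e2 : 0 < e / 2 by lra.
have eta0 : 0 < eta by rewrite mulr_gt0// mulr_gt0// exprn_gt0.
near=> t; have t0 : 0 <= t.
  by near: t; apply: nbhs_pinfty_ge; exact: num_real.
rewrite sub0r normrN (ger0_norm (g0 t)) ltNge; apply/negP => eg.
have td : t < t + d by rewrite ltrDl.
have [r /andP[tr rt] E] := ray_mean_value fd t0 td.
have r0 : 0 <= r := le_trans t0 (ltW tr).
have gr : e / 2 <= g r.
  have Ld : L * (r - t) <= e / 2.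
    have -> : e / 2 = (L + 1) * d by rewrite /d; field; lra.
    by rewrite ler_pM//; lra.
  have := gL t r t0 (ltW tr); rewrite ler_norml => /andP[_ ?].
  by move: Ld eg; lra.
have dr : df r <= - (c * (e / 2) ^+ 2).
  apply: le_trans (dfg r r0) _; rewrite lerN2 ler_pM2l// ler_sqr ?nnegrE//.
  exact: ltW.
have fE : f (t + d) - f t <= - eta.
  by rewrite E addrAC subrr add0r /eta -mulNr ler_pM2r.
have ftl : `|l - f t| < eta by near: t; move: eta0; exact: cvgr_dist_lt.
have ltd : l <= f (t + d) by apply: lf; rewrite addr_ge0// ltW.
by move: ftl; rewrite ltr_norml => /andP[h _]; lra.
Unshelve. all: by end_near. Qed.

(** The integrand is at most [- df t / c], whose integral is [(f 0 - l) / c] with [l] the limit of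
    [f]. *)
Lemma lyapunov_integral_lty f df q (c m : R) :
  derivable_on_ray f df -> {within `[0, +oo[%classic, continuous df} ->
  {within `[0, +oo[%classic, continuous q} -> 0 < c ->
  (forall t, 0 <= t -> m <= f t) ->
  (forall t, 0 <= t -> 0 <= q t) ->
  (forall t, 0 <= t -> df t <= - (c * q t)) ->
  (\int[lebesgue_measure]_(t in `[0%R, +oo[) (q t)%:E < +oo)%E.
Proof.
move=> fd dfc qc c0 fm q0 dfq.
have df0 t : 0 <= t -> df t <= 0.
  by move=> t0; apply: le_trans (dfq _ t0) _; rewrite oppr_le0 mulr_ge0 ?q0// ltW.
have [l fl _] := nonincreasing_ray_cvg
  (ray_nonincreasing fd (fun t t0 => df0 t (ltW t0))) fm.
(* The negative factor makes [k * df t] nonnegative, as the fundamental theorem of calculus on an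
   unbounded interval is applied to a nonnegative integrand. *)
pose k := - c^-1; have k0 : k <= 0 by rewrite oppr_le0 invr_ge0 ltW.
have kdfc : {within `[0, +oo[%classic, continuous (k \*: df)}.
  by move=> t; apply: cvgZ; [exact: cvg_cst | exact: dfc].
have int_kdf : (\int[lebesgue_measure]_(t in `[0%R, +oo[) (k * df t)%:E =
    (k * l)%:E - (k * f 0)%:E)%E.
  have [/continuous_within_itvcyP[_ f0] fd'] := fd.
  apply: (@ge0_continuous_FTC2y _ (k \*: df) (k \*: f)) => //.
  - by move=> t t0; rewrite mulr_le0// df0.
  - by apply: cvgZ => //; exact: cvg_cst.
  - by move=> t t0; apply: derivableZ; have [] := fd' t t0.
  - by apply: cvgZ => //; exact: cvg_cst.
  - move=> t; rewrite in_itv/= andbT => t0.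
    rewrite derive1E deriveZ; last by have [] := fd' t t0.
    by have [_ ->] := fd' t t0.
have m0y : measurable (`[0%R, +oo[%classic : set R) by [].
apply: (@le_lt_trans _ _
    (\int[lebesgue_measure]_(t in `[0%R, +oo[) (k * df t)%:E)%E).
  apply: ge0_le_integral => //.
  - by move=> t /=; rewrite in_itv/= andbT => t0; rewrite lee_fin q0.
  - by apply/measurable_EFinP; exact: subspace_continuous_measurable_fun.
  - by apply/measurable_EFinP; exact: subspace_continuous_measurable_fun.
  - move=> t /=; rewrite in_itv/= andbT => t0; rewrite lee_fin mulNr lerNr.
    by rewrite -(ler_pM2l c0) mulrA divff ?gt_eqF// mul1r mulrN dfq.
by rewrite int_kdf -EFinN -EFinD ltry.
Qed.

End RealFunctionsOnRay.

(** * Vector-valued curves on the half-line *)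

Section CurvesOnRay.
Context {R : realType} {H : completeNormedModType R} (ip : {dot H for idfun}).
Context (ip_norm : hilbert_norm ip).

Lemma cvg_ip (T : Type) (F : set_system T) (FF : Filter F) (u v : T -> H)
    (a b : H) :
  u t @[t --> F] --> a -> v t @[t --> F] --> b ->
  ip (u t) (v t) @[t --> F] --> (ip a b : R).
Proof.
move=> ua vb.
have ipP w w' : ip w w' = 2^-1 * (`|w + w'| ^+ 2 - `|w| ^+ 2 - `|w'| ^+ 2).
  by rewrite (sqr_normD ip_norm); field.
rewrite ipP; under eq_fun do rewrite ipP.
have cvg_sqr (w : T -> H) c : w t @[t --> F] --> c ->
    `|w t| ^+ 2 @[t --> F] --> (`|c| ^+ 2 : R).
  by move=> wc; rewrite expr2; under eq_fun do rewrite expr2;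
    apply: cvgM; exact: cvg_norm.
apply: cvgM; first exact: cvg_cst.
apply: cvgB; last exact: cvg_sqr.
by apply: cvgB; apply: cvg_sqr => //; exact: cvgD.
Qed.

Lemma is_derive_ray_interior (x : R -> H) (t : R) (v : H) :
  0 < t -> is_derive_ray x t v -> is_derive t (1 : R) x v.
Proof.
move=> t0 xv.
have cv : (fun h => h^-1 *: ((x \o shift t) (h *: (1 : R)) - x t)) @ 0^' --> v.
  move=> V Vv; have : \forall s \near within `[0, +oo[%classic t^',
    V ((s - t)^-1 *: (x s - x t)) by exact: xv.
  rewrite !near_withinE => /nbhs_ballP[e e0 eV].
  (* Increments smaller than [t] keep [h + t] inside the ray. *)
  have te0 : 0 < Num.min e t by rewrite lt_min e0.
  apply/nbhs_ballP; exists (Num.min e t) => //= h.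
  rewrite -ball_normE /= sub0r normrN lt_min => /andP[he ht] h0.
  have := eV (h + t); rewrite -ball_normE /= opprD addrCA subrr addr0 normrN.
  rewrite addrK /shift /= [h *: _]mulr1; apply => //.
    by rewrite -subr_eq0 addrK.
  by rewrite in_itv/= andbT; move: ht; rewrite ltr_norml => /andP[]; lra.
by split; [apply/cvg_ex; exists v | exact: cvg_lim].
Qed.

Lemma is_derive_ray_right_continuous (x : R -> H) (v : H) :
  is_derive_ray x 0 v -> x s @[s --> 0^'+] --> x 0.
Proof.
move=> xv.
have xv' : (s : R)^-1 *: (x s - x 0) @[s --> (0 : R)^'+] --> v.
  move=> V Vv; have : \forall s \near within `[0, +oo[%classic (0 : R)^',
    V ((s - 0)^-1 *: (x s - x 0)) by exact: xv.
  rewrite !near_withinE => /nbhs_ballP[e e0 eV].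
  apply/nbhs_ballP; exists e => //= s se s0.
  have := eV _ se; rewrite subr0; apply; first by rewrite gt_eqF.
  by rewrite /= in_itv/= andbT ltW.
have : s *: (s^-1 *: (x s - x 0)) + x 0 @[s --> (0 : R)^'+] --> 0 *: v + x 0.
  apply: cvgD; last exact: cvg_cst.
  by apply: cvgZ => //; apply: cvg_at_right_filter; exact: cvg_id.
rewrite scale0r add0r; apply: cvg_trans; apply: near_eq_cvg; near=> s.
have s0 : s != 0 by rewrite gt_eqF.
by rewrite scalerA divff// scale1r subrK.
Unshelve. all: by end_near. Qed.

Context (x dx : R -> H).
Context (x_dx : forall t : R, 0 <= t -> is_derive_ray x t (dx t)).

Lemma ray_continuous : {within `[0, +oo[%classic, continuous x}.
Proof.
apply/continuous_within_itvcyP; split.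
  move=> t; rewrite in_itv/= andbT => t0.
  apply: differentiable_continuous; apply/derivable1_diffP.
  by have [] := is_derive_ray_interior t0 (x_dx (ltW t0)).
exact: is_derive_ray_right_continuous (x_dx (lexx _)).
Qed.

Lemma ray_chain_rule (F : H -> R) (G : H -> H) : is_gradient ip F G ->
  derivable_on_ray (F \o x) (fun t => ip (G (x t)) (dx t)).
Proof.
move=> FG; split.
  move=> t; apply: (@continuous_comp (subspace _) _ _ x F).
    exact: ray_continuous.
  by apply: differentiable_continuous; have [] := FG (x t).
move=> t t0; have [xt xtE] := is_derive_ray_interior t0 (x_dx (ltW t0)).
have [dF dFE] := FG (x t).
have dxt : differentiable x t by apply/derivable1_diffP.
split; first exact/derivable1_diffP/differentiable_comp.
rewrite deriveE; last exact: differentiable_comp.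
by rewrite diff_comp//= dFE -xtE deriveE.
Qed.

(** The mean value theorem is scalar, so it is applied to the component of the curve along
    [x t - x s]. *)
Lemma ray_lipschitz (K : R) : (forall t, 0 <= t -> `|dx t| <= K) ->
  forall s t, 0 <= s -> s <= t -> `|x s - x t| <= K * (t - s).
Proof.
move=> dxK s t s0; rewrite le_eqVlt => /predU1P[<-|st].
  by rewrite !subrr normr0 mulr0.
have [->|xst] := eqVneq (x s - x t) 0.
  rewrite normr0 mulr_ge0 ?subr_ge0 ?(ltW st)//.
  exact: le_trans (dxK _ s0).
have [c /andP[sc _]] := ray_mean_value
  (ray_chain_rule (is_gradient_affine ip_norm (x t - x s) 0)) s0 st.
rewrite /= !addr0 -ipNr -ipDr -ip_norm => E.
have n0 : 0 < `|x t - x s| by rewrite distrC normr_gt0.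
rewrite distrC -(ler_pM2l n0) -expr2 E mulrA ler_pM2r ?subr_gt0//.
apply: le_trans (ip_le ip_norm _ _) _; rewrite ler_pM2l//.
by apply: dxK; exact: le_trans s0 (ltW sc).
Qed.

End CurvesOnRay.

(** * Inner products of strongly and weakly convergent families *)

Section WeakStrongLimits.
Context {R : realType} {H : completeNormedModType R} (ip : {dot H for idfun}).
Context (ip_norm : hilbert_norm ip).
Context (T : Type) (U : set_system T) {UP : ProperFilter U}.

Lemma cvg_ip_strong_weak (p u : T -> H) (p0 u0 : H) (M : R) :
  p t @[t --> U] --> p0 -> (\forall t \near U, `|u t| <= M) ->
  (forall y, ip (u t) y @[t --> U] --> (ip u0 y : R)) ->
  ip (p t) (u t) @[t --> U] --> (ip p0 u0 : R).
Proof.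
move=> pp0 uM uu0.
have ipE' t : ip (p t) (u t) = ip (p t - p0) (u t) + ip (u t) p0.
  by rewrite ipDl ipNl (ipC ip (u t)) subrK.
under eq_fun do rewrite ipE'.
rewrite (ipC ip p0) -[ip u0 p0]add0r; apply: cvgD; last exact: uu0.
apply/cvgrPdist_le => e e0.
have M1 : 0 < `|M| + 1 by rewrite ltr_wpDl.
near=> t; rewrite sub0r normrN (le_trans (cauchy_schwarz ip_norm _ _))//.
rewrite (@le_trans _ _ (`|p t - p0| * (`|M| + 1)))//.
  rewrite ler_wpM2l//; have : `|u t| <= M by near: t.
  by have := ler_norm M; lra.
rewrite -ler_pdivlMr// distrC; near: t.
by apply: cvgr_dist_le => //; rewrite divr_gt0.
Unshelve. all: by end_near. Qed.

(** Serves to pass monotonicity inequalities to the limit along the trajectory. *)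
Lemma ip_weak_limit_ge0 (p u : T -> H) (p0 u0 q w : H) (M : R) :
  p t @[t --> U] --> p0 -> (\forall t \near U, `|u t| <= M) ->
  (forall y, ip (u t) y @[t --> U] --> (ip u0 y : R)) ->
  (\forall t \near U, 0 <= ip (p t - q) (u t - w)) ->
  0 <= ip (p0 - q) (u0 - w).
Proof.
move=> pp0 uM uu0; apply: cvgr_to_ge.
apply: (@cvg_ip_strong_weak _ _ _ _ (M + `|w|)).
- by apply: cvgB => //; exact: cvg_cst.
- by apply: filterS uM => t utM; rewrite (le_trans (ler_normB _ _))// lerD2r.
- move=> y; under eq_fun do rewrite ipDl; rewrite ipDl.
  by apply: cvgD; [exact: uu0 | exact: cvg_cst].
Qed.

End WeakStrongLimits.

(** * The forward-backward dynamics *)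

Section ForwardBackward.
Context {R : realType} {H : completeNormedModType R} (ip : {dot H for idfun}).
Context (ip_norm : hilbert_norm ip).
Context (Phi : H -> \bar R) (Phi_convex : econvex Phi).
Context (Phi_lsc : lower_semicontinuous Phi) (Phi_proper : proper_fun Phi).
Context (B : H -> H) (B_maxmon : maximal_monotone_op ip (fun u => [set B u])).
Context (beta : R) (beta_gt0 : 0 < beta) (B_coco : cocoercive ip beta B).

Local Notation S := (solution_set ip Phi B).

Lemma solution_setP z : S z <-> subdiff ip Phi z (- B z).
Proof.
split=> [[p zp /eqP]|zB]; last by exists (- B z) => //; rewrite addNr.
by rewrite addr_eq0 => /eqP <-.
Qed.

(** Monotonicity of the subdifferential gives [ip (B z - B z') (z - z') <= 0], and cocoercivity then
    annihilates [B z - B z']. *)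
Lemma solution_set_B z z' : S z -> S z' -> B z = B z'.
Proof.
move=> /solution_setP Sz /solution_setP Sz'.
have := subdiff_monotone Phi_proper Sz Sz'; have := B_coco z z'.
rewrite -opprD ipNl => h1 h2.
have : beta * `|B z - B z'| ^+ 2 <= 0 by move: h1 h2; lra.
rewrite pmulr_rle0// => h.
have /eqP : `|B z - B z'| ^+ 2 == 0 by rewrite eq_le h sqr_ge0.
by move/eqP; rewrite sqrf_eq0 normr_eq0 subr_eq0 => /eqP.
Qed.

Lemma B_lipschitz u v : `|B u - B v| <= beta^-1 * `|u - v|.
Proof.
have [->|Buv] := eqVneq (B u - B v) 0.
  by rewrite normr0 mulr_ge0// invr_ge0 ltW.
rewrite ler_pdivlMl// -(ler_pM2r (_ : 0 < `|B u - B v|)) ?normr_gt0//.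
rewrite -mulrA -expr2 (mulrC `|u - v|).
exact: le_trans (B_coco u v) (ip_le ip_norm _ _).
Qed.

Lemma B_continuous : continuous B.
Proof.
move=> u; apply/cvgrPdist_le => e e0; near=> v.
rewrite (le_trans (B_lipschitz _ _))// ler_pdivrMl//; near: v.
by apply: cvgr_dist_le => //; rewrite mulr_gt0.
Unshelve. all: by end_near. Qed.

Context (mu : R) (mu_gt0 : 0 < mu).

Definition fb_field (u : H) := prox ip mu Phi (u - mu *: B u) - u.

Context (z0 : H) (Sz0 : S z0).

(** Makes [dx] Lipschitz in time along a Lipschitz trajectory, as Barbalat's argument requires. *)
Lemma fb_field_lipschitz u v :
  `|fb_field u - fb_field v| <= (2 + mu / beta) * `|u - v|.
Proof.
have sub0 := (solution_setP z0).1 Sz0.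
rewrite /fb_field opprD addrACA -opprD (le_trans (ler_normB _ _))//.
have := prox_nonexpansive ip_norm Phi_convex Phi_lsc Phi_proper sub0
  (u - mu *: B u) (v - mu *: B v) mu_gt0.
have : `|u - mu *: B u - (v - mu *: B v)| <= `|u - v| + mu / beta * `|u - v|.
  rewrite opprD addrACA -opprD -scalerBr (le_trans (ler_normB _ _))// lerD2l.
  by rewrite normrZ gtr0_norm// -mulrA ler_pM2l// B_lipschitz.
lra.
Qed.

Lemma fb_field_eq0 z : S z -> fb_field z = 0.
Proof.
move=> /solution_setP Sz; apply/eqP; rewrite subr_eq0 -scalerN.
by rewrite (prox_fixpoint ip_norm Phi_convex Phi_lsc Phi_proper Sz mu_gt0 Sz).
Qed.

Context (x0 : H) (x dx : R -> H).
Context (x_sol : classical_solution ip mu Phi B x0 x dx).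

Lemma fb_fieldE t : 0 <= t -> dx t = fb_field (x t).
Proof.
have [_ _ eq_dx _] := x_sol => /eq_dx /eqP; rewrite subr_eq0 => /eqP E.
by rewrite /fb_field -E addrK.
Qed.

Lemma trajectory_subdiff t : 0 <= t ->
  subdiff ip Phi (x t + dx t) (- (mu^-1 *: dx t) - B (x t)).
Proof.
have [_ _ eq_dx _] := x_sol => /eq_dx /eqP; rewrite subr_eq0 => /eqP E.
have := prox_subdiff ip_norm Phi_convex Phi_lsc Phi_proper
  ((solution_setP z0).1 Sz0) (x t - mu *: B (x t)) mu_gt0.
rewrite -E (addrC (dx t)).
suff -> : mu^-1 *: (x t - mu *: B (x t) - (x t + dx t)) =
  - (mu^-1 *: dx t) - B (x t) by [].
rewrite opprD addrACA subrr add0r scalerBr scalerN scalerA mulVf ?gt_eqF//.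
by rewrite scale1r addrC.
Qed.

Lemma trajectory_dissipation z t : S z -> 0 <= t ->
  mu^-1 * ip (x t - z) (dx t) + mu^-1 * `|dx t| ^+ 2
    + beta * `|B (x t) - B z| ^+ 2 + ip (B (x t) - B z) (dx t) <= 0.
Proof.
move=> /solution_setP Sz t0.
have := subdiff_monotone Phi_proper (trajectory_subdiff t0) Sz.
have := B_coco (x t) z; rewrite (ip_norm (dx t)) !ipE.
rewrite (ipC ip (dx t) (x t)) (ipC ip (dx t) z) => h1 h2.
by move: h1 h2; lra.
Qed.

(** * Asymptotics from an abstract family of Lyapunov functions *)

Section Lyapunov.
Context (W : H -> H -> R) (G : H -> H -> H) (k c : R).
Context (k_gt0 : 0 < k) (c_gt0 : 0 < c).
Context (W_grad : forall z, S z -> is_gradient ip (W z) (G z)).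
Context (G_cont : forall z, S z -> continuous (G z)).
Context (W_coercive : forall z u, S z -> k * `|u - z| ^+ 2 <= W z u).
Context (W_decay : forall z (t : R), S z -> 0 <= t ->
  ip (G z (x t)) (dx t) <=
    - (c * (`|dx t| ^+ 2 + `|B (x t) - B z| ^+ 2))).
Context (W_affine : forall z z', S z -> S z' -> exists b, forall u,
  W z u - W z' u = 2 * k * ip u (z' - z) + b).

Let ray z : S z ->
  derivable_on_ray (W z \o x) (fun t => ip (G z (x t)) (dx t)).
Proof. by move=> Sz; apply: ray_chain_rule; [case: x_sol | exact: W_grad]. Qed.

Let W_ge0 z u : S z -> 0 <= W z u.
Proof.
move=> Sz; apply: le_trans (W_coercive _ Sz).
exact: mulr_ge0 (ltW k_gt0) (sqr_ge0 _).
Qed.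

Let decay_le0 z (t : R) : S z -> 0 < t -> ip (G z (x t)) (dx t) <= 0.
Proof.
move=> Sz t0; apply: le_trans (W_decay Sz (ltW t0)) _.
by rewrite oppr_le0 mulr_ge0 ?addr_ge0 ?sqr_ge0 ?(ltW c_gt0).
Qed.

(** Coercivity bounds the squared distance to [z0]; [r <= 1 + r ^+ 2] avoids a square root. *)
Let M := 1 + W z0 (x 0) / k.

Let x_bounded t : 0 <= t -> `|x t - z0| <= M.
Proof.
move=> t0.
have h := ray_nonincreasing (ray Sz0) (fun s => @decay_le0 z0 s Sz0) (lexx 0) t0.
have : `|x t - z0| ^+ 2 <= W z0 (x 0) / k.
  by rewrite ler_pdivlMr// mulrC (le_trans (W_coercive _ Sz0)).
rewrite /M; have := sqr_ge0 `|x t - z0|; have := sqr_ge0 (`|x t - z0| - 1).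
by rewrite sqrrB; lra.
Qed.

Let L := 2 + mu / beta.

Let L_ge0 : 0 <= L.
Proof. by rewrite addr_ge0// divr_ge0 ?ltW. Qed.

Let M_ge0 : 0 <= M.
Proof. exact: le_trans (x_bounded (lexx 0)). Qed.

(** The Lipschitz field vanishes at the solution [z0], so it is controlled by the distance to
    [z0]. *)
Let dx_bounded t : 0 <= t -> `|dx t| <= L * M.
Proof.
move=> t0; rewrite fb_fieldE// -[fb_field _]subr0 -(fb_field_eq0 Sz0).
apply: le_trans (fb_field_lipschitz _ _) _.
by rewrite ler_wpM2l// x_bounded.
Qed.

Let x_lip s t : 0 <= s -> s <= t -> `|x s - x t| <= L * M * (t - s).
Proof. by apply: (ray_lipschitz ip_norm _ dx_bounded); case: x_sol. Qed.

Let dx_cvg0 : dx t @[t --> +oo] --> (0 : H).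
Proof.
apply/norm_cvg0P.
apply: (lyapunov_decay_cvg0 (c := c) (L := L * (L * M)) (m := 0) (ray Sz0)) => //.
- by rewrite mulr_ge0// mulr_ge0.
- by move=> t t0; exact: W_ge0.
- move=> t t0; apply: le_trans (W_decay Sz0 t0) _.
  by rewrite lerN2 ler_pM2l// lerDl sqr_ge0.
- move=> s t s0 st; have t0 := le_trans s0 st.
  rewrite (le_trans (ler_dist_dist _ _))// !fb_fieldE//.
  rewrite (le_trans (fb_field_lipschitz _ _))// -mulrA ler_wpM2l//.
  exact: x_lip.
Qed.

Let Bx_cvg z : S z -> B (x t) @[t --> +oo] --> B z.
Proof.
move=> Sz; apply/subr_cvg0/norm_cvg0P.
apply: (lyapunov_decay_cvg0 (c := c) (L := beta^-1 * (L * M)) (m := 0) (ray Sz)) => //.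
- by rewrite mulr_ge0// ?mulr_ge0// invr_ge0 ltW.
- by move=> t t0; exact: W_ge0.
- move=> t t0; apply: le_trans (W_decay Sz t0) _.
  by rewrite lerN2 ler_pM2l// lerDr sqr_ge0.
- move=> s t s0 st; have t0 := le_trans s0 st.
  rewrite (le_trans (ler_dist_dist _ _))// opprD addrACA subrr addr0.
  rewrite (le_trans (B_lipschitz _ _))// -mulrA ler_wpM2l ?invr_ge0 ?(ltW beta_gt0)//.
  exact: x_lip.
Qed.

Let dx_square_integrable :
  (\int[lebesgue_measure]_(t in `[0%R, +oo[) (`|dx t| ^+ 2)%:E < +oo)%E.
Proof.
have [x_dx dx_cont _ _] := x_sol.
have x_cont := ray_continuous x_dx.
apply: (lyapunov_integral_lty (c := c) (m := 0) (ray Sz0)) => //.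
- move=> t; apply: cvg_ip => //; last exact: dx_cont.
  apply: (@continuous_comp (subspace _) _ _ x (G z0)); first exact: x_cont.
  exact: G_cont.
- rewrite (_ : (fun _ => _) = (fun t : R => `|dx t| * `|dx t|)).
    by move=> t; apply: cvgM; apply: cvg_norm; exact: dx_cont.
  by apply/funext => t; rewrite expr2.
- by move=> t _; exact: W_ge0.
- move=> t t0; apply: le_trans (W_decay Sz0 t0) _.
  by rewrite lerN2 ler_pM2l// lerDl sqr_ge0.
Qed.

Let x_near_bounded : \forall t \near +oo, `|x t| <= M + `|z0|.
Proof.
near=> t; have t0 : 0 <= t.
  by near: t; apply: nbhs_pinfty_ge; exact: num_real.
rewrite -[x t](subrK z0) (le_trans (ler_normD _ _))// lerD2r.
exact: x_bounded.
Unshelve. all: by end_near. Qed.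

Let pinfty_ge0 : \forall t \near +oo, (0 : R) <= t.
Proof. by apply: nbhs_pinfty_ge; exact: num_real. Qed.

Let weak_limit_solution (U : set_system R) v : ProperFilter U ->
  +oo%R `<=` U -> (forall y, ip (x t) y @[t --> U] --> (ip v y : R)) -> S v.
Proof.
move=> UP oU xv.
have xM := oU _ x_near_bounded.
have BxU : B (x t) @[t --> U] --> B z0.
  by apply: cvg_trans (Bx_cvg Sz0); exact: cvg_fmap2.
have dxU : dx t @[t --> U] --> (0 : H).
  by apply: cvg_trans dx_cvg0; exact: cvg_fmap2.
have BvE : B v = B z0.
  apply/esym.
  (* Adjoining [(v, B z0)] to the graph of [B] keeps it monotone, by a strong-weak limit, so
     maximality forces [B z0 = B v]. *)
  pose A' u := [set B u] `|` [set p | u = v /\ p = B z0].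
  have A'_mono : monotone_op ip A'.
    have h u : 0 <= ip (B z0 - B u) (v - u).
      apply: (ip_weak_limit_ge0 ip_norm BxU xM xv); apply: nearW => t.
      by apply: B_maxmon.1.
    move=> u w p q [->|[-> ->]] [->|[-> ->]].
    - by apply: B_maxmon.1.
    - by rewrite -opprB ipNl -ipNr opprB.
    - exact: h.
    - by rewrite !subrr -(scale0r (0 : H)) ipZl mul0r.
  apply: (B_maxmon.2 A' A'_mono _ v (B z0)); last by right.
  by move=> u p ->; left.
apply/solution_setP.
apply: (subdiff_maximal ip_norm Phi_convex Phi_lsc Phi_proper
  ((solution_setP z0).1 Sz0)) => u q uq.
(* Along [U] the subgradients of [trajectory_subdiff] tend strongly to [- B v], while their base
   points [x t + dx t] tend weakly to [v]. *)
apply: (@ip_weak_limit_ge0 _ _ _ ip_norm _ U _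
  (fun t => - (mu^-1 *: dx t) - B (x t)) (fun t => x t + dx t) _ _ _ _
  (M + `|z0| + L * M)).
- rewrite BvE -[- B z0]add0r -[X in X - _]oppr0 -[X in - X - _](scaler0 H mu^-1).
  apply: cvgB => //; apply: cvgN; apply: cvgZ => //; exact: cvg_cst.
- have := oU _ pinfty_ge0; move: xM; apply: filterS2 => t xtM t0.
  by rewrite (le_trans (ler_normD _ _))// lerD// dx_bounded.
- move=> y; under eq_fun do rewrite ipDl; rewrite -[ip v y]addr0; apply: cvgD => //.
  rewrite -[X in _ --> X](_ : ip 0 y = 0); last first.
    by rewrite -(scale0r (0 : H)) ipZl mul0r.
  by apply: cvg_ip => //; exact: cvg_cst.
- have := oU _ pinfty_ge0; apply: filterS => t t0.
  exact: (subdiff_monotone Phi_proper (trajectory_subdiff t0) uq).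
Qed.

(* Opial: [W z (x t)] has a limit for every [z] in [S], and the difference of
   two such functions only involves the component of [x t] along [z' - z]. *)
Let weak_limit_unique (U U' : set_system R) v v' :
  ProperFilter U -> ProperFilter U' -> +oo%R `<=` U -> +oo%R `<=` U' ->
  (forall y, ip (x t) y @[t --> U] --> (ip v y : R)) ->
  (forall y, ip (x t) y @[t --> U'] --> (ip v' y : R)) -> v = v'.
Proof.
move=> UP UP' oU oU' xv xv'.
have Sv := weak_limit_solution UP oU xv.
have Sv' := weak_limit_solution UP' oU' xv'.
have W_cvg z : S z -> exists l : R, W z (x t) @[t --> +oo] --> l.
  move=> Sz; have [|l Wl _] := nonincreasing_ray_cvg (m := 0)
    (ray_nonincreasing (ray Sz) (fun t => @decay_le0 z t Sz)).
    by move=> t _; exact: W_ge0.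
  by exists l.
have [l Wl] := W_cvg _ Sv; have [l' Wl'] := W_cvg _ Sv'.
have [b bE] := W_affine Sv Sv'.
have ipE' t : ip (x t) (v' - v) = (2 * k)^-1 * (W v (x t) - W v' (x t) - b).
  by rewrite bE; field; rewrite gt_eqF.
have xl : ip (x t) (v' - v) @[t --> +oo] --> ((2 * k)^-1 * (l - l' - b) : R).
  under eq_fun do rewrite ipE'.
  apply: cvgM; first exact: cvg_cst.
  by apply: cvgB; [exact: cvgB | exact: cvg_cst].
have xlU : ip (x t) (v' - v) @[t --> U] --> ((2 * k)^-1 * (l - l' - b) : R).
  by apply: cvg_trans xl; exact: cvg_fmap2.
have xlU' : ip (x t) (v' - v) @[t --> U'] --> ((2 * k)^-1 * (l - l' - b) : R).
  by apply: cvg_trans xl; exact: cvg_fmap2.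
have e : ip v (v' - v) = ip v' (v' - v).
  by transitivity ((2 * k)^-1 * (l - l' - b));
    [exact: (cvg_unique _ (xv _) xlU) | exact: (cvg_unique _ xlU' (xv' _))].
have : `|v' - v| ^+ 2 = 0 by rewrite ip_norm ipDl ipNl e subrr.
by move/eqP; rewrite sqrf_eq0 normr_eq0 subr_eq0 => /eqP.
Qed.

Lemma lyapunov_asymptotic_properties : asymptotic_properties ip Phi B x dx.
Proof.
split; last by split.
- have weak (U : set_system R) : UltraFilter U -> +oo%R `<=` U ->
      exists v, forall y, ip (x t) y @[t --> U] --> (ip v y : R).
    move=> UU oU.
    exact: (ultra_bounded_weakly_cvg ip_norm UU (oU _ x_near_bounded)).
  (* One ultrafilter supplies the candidate limit; uniqueness transfers it to all the others. *)
  have [U [UU oU]] := ultraFilterLemma (@proper_pinfty_nbhs R).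
  have [v xv] := weak U UU oU.
  exists v; first exact: weak_limit_solution xv.
  apply: weakly_cvg_of_ultra => U' UU' oU'.
  have [v' xv'] := weak U' UU' oU'.
  by rewrite (weak_limit_unique _ _ oU oU' xv xv').
- by split=> [z z'|z Sz]; [exact: solution_set_B | exact: Bx_cvg].
Qed.

End Lyapunov.
End ForwardBackward.

(** * The two concrete Lyapunov functions *)

Lemma segment_is_derive_ray (R : realType) (H : completeNormedModType R)
    (z h : H) (t : R) : is_derive_ray (fun s : R => z + s *: h) t h.
Proof.
rewrite /is_derive_ray.
apply: (@cvg_trans _ (h @[s --> within (`[0, +oo[%classic : set R) t^'])).
  apply: near_eq_cvg; rewrite !near_withinE; near=> s => st _.
  rewrite opprD addrACA subrr add0r -scalerBl scalerA mulVf ?scale1r//.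
  by rewrite subr_eq0.
exact: cvg_cst.
Unshelve. all: by end_near. Qed.

(** By the mean value theorem on the segment from [z] to [u], the increment of [Psi] is a slope at
    an intermediate point, which monotonicity places above the slope at [z]. *)
Lemma monotone_gradient_tangent_le (R : realType) (H : completeNormedModType R)
    (ip : {dot H for idfun}) (Psi : H -> R) (B : H -> H) :
  is_gradient ip Psi B -> (forall u v, 0 <= ip (B u - B v) (u - v)) ->
  forall z u, Psi z + ip (B z) (u - z) <= Psi u.
Proof.
move=> PsiB B_mono z u.
have Psi_ray := ray_chain_rule
  (fun t (_ : 0 <= t) => @segment_is_derive_ray R H z (u - z) t) PsiB.
have [c /andP[c0 _]] := ray_mean_value Psi_ray (lexx 0) ltr01.
rewrite /= scale1r scale0r addr0 [z + _]addrC subrK subr0 mulr1 => E.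
have := B_mono (z + c *: (u - z)) z.
rewrite addrAC subrr add0r ipZr pmulr_rge0// ipDl ipNl.
by move: E; lra.
Qed.

Theorem theorem4p2 (R : realType) (H : completeNormedModType R)
    (ip : {dot H for idfun}) (ip_norm : hilbert_norm ip)
    (Phi : H -> \bar R) (Phi_convex : econvex Phi)
    (Phi_lsc : lower_semicontinuous Phi) (Phi_proper : proper_fun Phi)
    (B : H -> H) (B_maxmon : maximal_monotone_op ip (fun u => [set B u]))
    (beta : R) (beta_gt0 : 0 < beta) (B_coco : cocoercive ip beta B)
    (S_nonempty : solution_set ip Phi B !=set0)
    (mu : R) (mu_gt0 : 0 < mu) (x0 : H) (x dx : R -> H)
    (x_sol : classical_solution ip mu Phi B x0 x dx) :
  (mu < 4 * beta -> asymptotic_properties ip Phi B x dx) /\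
  (forall Psi : H -> R,
     convex_function (setT : set (convex_lmodType H)) Psi ->
     is_gradient ip Psi B ->
     asymptotic_properties ip Phi B x dx).
Proof.
have [z0 Sz0] := S_nonempty.
pose k := (2 * mu)^-1.
have k2 : 2 * k = mu^-1 by rewrite /k; field; rewrite gt_eqF.
have k_gt0 : 0 < k by rewrite invr_gt0 mulr_gt0.
have sqr_norm_affine z z' u : k * `|u - z| ^+ 2 - k * `|u - z'| ^+ 2 =
    2 * k * ip u (z' - z) + k * (`|z| ^+ 2 - `|z'| ^+ 2).
  by rewrite !(sqr_normB ip_norm) ipDr ipNr; ring.
have dissipation := trajectory_dissipation ip_norm Phi_convex Phi_lsc
  Phi_proper B_coco mu_gt0 Sz0 x_sol.
have lyapunov := lyapunov_asymptotic_properties ip_norm Phi_convex Phi_lsc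
  Phi_proper B_maxmon beta_gt0 B_coco mu_gt0 Sz0 x_sol.
have sub_cont z : continuous (fun u : H => (2 * k) *: (u - z)).
  move=> u; apply: cvgZ; first exact: cvg_cst.
  by apply: cvgB => //; exact: cvg_cst.
split=> [mu_lt|Psi _ PsiB].
- pose a := mu^-1; have a_gt0 : 0 < a by rewrite invr_gt0.
  have ab : 1 / 4 < a * beta.
    by rewrite /a ltr_pdivlMl//; lra.
  (* Chosen so that [(a - c) * (beta - c) >= 1 / 4], which makes the quadratic
     form [(a - c) * X ^+ 2 - X * Y + (beta - c) * Y ^+ 2] nonnegative. *)
  pose c := (a * beta - 1 / 4) / (a + beta).
  have ab_gt0 : 0 < a + beta by rewrite addr_gt0.
  have c_gt0 : 0 < c by rewrite divr_gt0// subr_gt0.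
  apply: (lyapunov (fun z u => k * `|u - z| ^+ 2)
    (fun z u => (2 * k) *: (u - z)) k c) => //.
  + by move=> z _; exact: is_gradient_sqr_norm.
  + move=> z t Sz t0; have := dissipation z t Sz t0.
    rewrite ipZl k2 -/a.
    have := ip_le ip_norm (- (B (x t) - B z)) (dx t).
    rewrite ipNl normrN.
    have n1 := normr_ge0 (dx t); have n2 := normr_ge0 (B (x t) - B z).
    move: `|dx t| `|B (x t) - B z| n1 n2 => X Y X0 Y0 h1 h2.
    have cE : c * (a + beta) = a * beta - 1 / 4 by rewrite divfK ?gt_eqF.
    have ac : 0 < a - c.
      by rewrite subr_gt0 ltr_pdivrMr//; have := mulr_gt0 a_gt0 a_gt0; lra.
    (* The factor [4 * (a - c)] completes the square without division; by [cE] the remainder is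
       [4 * (c ^+ 2 * Y ^+ 2)]. *)
    have : 0 <= 4 * (a - c) * ((a - c) * X ^+ 2 + (beta - c) * Y ^+ 2 - X * Y).
      have := sqr_ge0 (2 * (a - c) * X - Y).
      have := mulr_ge0 (sqr_ge0 c) (sqr_ge0 Y).
      have -> : 4 * (a - c) * ((a - c) * X ^+ 2 + (beta - c) * Y ^+ 2 - X * Y) =
        (2 * (a - c) * X - Y) ^+ 2 + 4 * (c ^+ 2 * Y ^+ 2)
        + 4 * (a * beta - 1 / 4 - c * (a + beta)) * Y ^+ 2 by field.
      by rewrite cE subrr mulr0 mul0r; lra.
    rewrite pmulr_rge0 ?mulr_gt0// => h3.
    by lra.
  + move=> z z' _ _; exists (k * (`|z| ^+ 2 - `|z'| ^+ 2)) => u.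
    exact: sqr_norm_affine.
- have B_mono u v : 0 <= ip (B u - B v) (u - v).
    by apply: B_maxmon.1.
  have B_cont := B_continuous ip_norm beta_gt0 B_coco.
  (* The Bregman term takes up the cross term exactly, so the dissipation keeps its full
     coefficients [mu^-1] and [beta]. *)
  pose c := Num.min mu^-1 beta.
  have c_gt0 : 0 < c by rewrite lt_min invr_gt0 mu_gt0.
  (* The Bregman distance is written as [Psi] plus an affine function, so that its gradient is a sum
     of known ones. *)
  apply: (lyapunov
    (fun z => (fun u => k * `|u - z| ^+ 2) \+
      (Psi \+ (fun u => ip (- B z) u + (ip (B z) z - Psi z))))
    (fun z => (fun u => (2 * k) *: (u - z)) \+ (B \+ (fun=> - B z))) k c) => //.
  + move=> z _; apply: is_gradientD; first exact: is_gradient_sqr_norm.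
    by apply: is_gradientD => //; exact: is_gradient_affine.
  + move=> z _ u; apply: cvgD; first exact: sub_cont.
    by apply: cvgD; [exact: B_cont | exact: cvg_cst].
  + move=> z u _; rewrite /= lerDl ipNl.
    by have := monotone_gradient_tangent_le PsiB B_mono z u; rewrite ipDr ipNr; lra.
  + move=> z t Sz t0; have h := dissipation z t Sz t0.
    rewrite /= ipDl ipZl k2.
    have c_mu : c <= mu^-1 by rewrite ge_min lexx.
    have c_beta : c <= beta by rewrite ge_min lexx orbT.
    have := ler_wpM2r (sqr_ge0 `|dx t|) c_mu.
    have := ler_wpM2r (sqr_ge0 `|B (x t) - B z|) c_beta.
    lra.
  (* Since [B z = B z'], the two Bregman distances differ by a constant, and only the quadratic
     parts contribute a term linear in [u]. *)
  + move=> z z' Sz Sz'; have BzE := solution_set_B Phi_proper beta_gt0 B_coco Sz Sz'.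
    exists (k * (`|z| ^+ 2 - `|z'| ^+ 2) + (ip (B z) z - Psi z)
      - (ip (B z) z' - Psi z')) => u.
    have := sqr_norm_affine z z' u; rewrite /= -BzE ipNl.
    lra.
Qed.
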